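(* For all integers $n\ge0$ and $\alpha\ge1$: \[ \overline{p}_{8}(6n+5)\equiv0\pmod{3}, \] \[ \overline{p}_{8}(16n+10)\equiv0\pmod{16}, \] \[ \overline{p}_{8}\bigl(2^{\alpha}(16n+10)\bigr)\equiv0\pmod{16}, \] \[ \overline{p}_{8}(32n+28)\equiv0\pmod{16}, \] \[ \overline{p}_{8}(16n+14)\equiv0\pmod{32}, \] \[ \overline{p}_{8}\bigl(2^\alpha(8n+7)\bigr)\equiv0\pmod{32}, \] \[ \overline{p}_{8}(8n+7)\equiv0\pmod{64}. \]
   Context: For $k\ge1$ let $f_k=\prod_{m\ge1}(1-q^{km})$. $\overline{p}_8(n)$ denotes the number of 2-color overpartitions of $n$ (the first occurrence of a part of each color may be overlined) in which one of the two colors appears only in parts that are multiples of $8$; its generating function is $\sum_{n\ge0}\overline{p}_8(n)q^n=\dfrac{f_2f_{16}}{f_1^2f_8^2}$. *)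

(* Defs.v *)
From mathcomp Require Import all_boot.

Set Implicit Arguments.
Unset Strict Implicit.
Unset Printing Implicit Defensive.

(* A finite description of a 2-colored overpartition whose parts are at most n.
   At the index (i, c), where i : 'I_n stands for the part i.+1 and c for its
   color, the value (m, o) records the multiplicity m of that colored part and
   whether its first occurrence is overlined.  The multiplicities of a partition
   of n are at most n, so the bound 'I_n.+1 is no restriction.  The color [true]
   is the one whose parts have to be multiples of l. *)
Definition colored_overpart (n : nat) : finType :=
  {ffun 'I_n * bool -> 'I_n.+1 * bool}.

Definition mult n (p : colored_overpart n) (i : 'I_n) (c : bool) : nat :=
  (p (i, c)).1.

Definition overlined n (p : colored_overpart n) (i : 'I_n) (c : bool) : bool :=
  (p (i, c)).2.

Definition is_overpart (l n : nat) (p : colored_overpart n) : bool :=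
  [&& \sum_(i < n) \sum_(c : bool) i.+1 * mult p i c == n,
      [forall i, forall c, overlined p i c ==> (0 < mult p i c)]
    & [forall i, (0 < mult p i true) ==> (l %| i.+1)]].

Definition pbar (l n : nat) : nat :=
  #|[set p : colored_overpart n | is_overpart l p]|.

(* Main.v *)
Require Import Defs.
From HB Require Import structures.
From mathcomp Require Import all_boot all_order all_algebra boolp ring zify.

Set Implicit Arguments.
Unset Strict Implicit.
Unset Printing Implicit Defensive.

Import GRing.Theory.

(* Write phi for the theta series of the squares, psi for that of the
   triangular numbers, phi_k for phi(q^k) and V for the substitution q -> q^2.
   Gauss's product turns the generating function into 1 / (phi(-q) phi(-q^8)),
   and phi(q) phi(-q) = phi(-q^2)^2 rewrites it as
     phi_1 phi_2^2 phi_4^4 / phi(-q^8)^9.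
   The even part of phi is phi_4 and its odd part is 2 q psi(q^8), hence
   phi^2 = phi_2^2 + 4 q psi(q^4)^2, so every bisection of the generating
   function is again a product of values of phi and psi; each residue class
   collects its power of 2 from the odd parts.

   For the two infinite families, the series of pbar(4n) is
   phi_1^7 / phi(-q^2)^9.  Because the square of (phi - 1) / 2 is congruent
   mod 2 to its image by V, this is mod 32 an integral combination of products
   of at most three values phi_1, phi_2, phi_4, phi_8, and the map n -> 2n acts
   on these products by an explicit finite recursion.

   Mod 3, h = psi phi(-q)^2 satisfies h^2 = h(q^2) phi(-q)^3; comparing the
   first offending coefficients shows that h, like any cube, is supported on
   multiples of 3.  The odd part of the generating function is a product of
   such series with phi(-q), whose exponents are squares. *)

(** * The ring of integer power series, its bisections, and the substitutions q -> q^2 and q ->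
    -q *)

Section PowerSeries.
Local Open Scope ring_scope.

Record fps := Fps { coef : nat -> int }.

HB.instance Definition _ := gen_eqMixin fps.
HB.instance Definition _ := gen_choiceMixin fps.

Implicit Types A B C : fps.

Lemma fpsP A B : (forall n, coef A n = coef B n) -> A = B.
Proof. by case: A B => [a] [b] /= /funext->. Qed.

Definition fps_const (c : int) := Fps (fun n => if n == 0%N then c else 0).
Definition fps_opp A := Fps (fun n => - coef A n).
Definition fps_add A B := Fps (fun n => coef A n + coef B n).
Definition fps_mul A B :=
  Fps (fun n => \sum_(i < n.+1) coef A i * coef B (n - i)).

Fact fps_addA : associative fps_add.
Proof. by move=> A B C; apply: fpsP => n /=; rewrite addrA. Qed.
Fact fps_addC : commutative fps_add.
Proof. by move=> A B; apply: fpsP => n /=; rewrite addrC. Qed.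
Fact fps_add0 : left_id (fps_const 0) fps_add.
Proof. by move=> A; apply: fpsP => n /=; rewrite if_same add0r. Qed.
Fact fps_addN : left_inverse (fps_const 0) fps_opp fps_add.
Proof. by move=> A; apply: fpsP => n /=; rewrite if_same addNr. Qed.

HB.instance Definition _ :=
  GRing.isZmodule.Build fps fps_addA fps_addC fps_add0 fps_addN.

Definition trunc N A : {poly int} := \poly_(i < N.+1) coef A i.

(** Each coefficient of a Cauchy product is a coefficient of a product of polynomials, so
    associativity and commutativity are inherited from [{poly int}]. *)
Lemma coef_mul_trunc N A B n : (n <= N)%N ->
  coef (fps_mul A B) n = (trunc N A * trunc N B)`_n.
Proof.
move=> nN; rewrite coefM; apply: eq_bigr => i _; rewrite !coef_poly.
have iN : (i <= n)%N by rewrite -ltnS.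
by rewrite !ltnS (leq_trans iN nN) (leq_trans (leq_subr _ _) nN).
Qed.

Lemma coef_trunc N A n : (n <= N)%N -> (trunc N A)`_n = coef A n.
Proof. by move=> nN; rewrite coef_poly ltnS nN. Qed.

Fact fps_mulA : associative fps_mul.
Proof.
move=> A B C; apply: fpsP => n.
rewrite -[LHS]/(coef (fps_mul A (fps_mul B C)) n).
suff [-> ->] : coef (fps_mul A (fps_mul B C)) n
    = (trunc n A * (trunc n B * trunc n C))`_n
  /\ coef (fps_mul (fps_mul A B) C) n
    = (trunc n A * trunc n B * trunc n C)`_n by rewrite mulrA.
split; rewrite (@coef_mul_trunc n) // !coefM; apply: eq_bigr => i _.
- by congr (_ * _);
  rewrite coef_trunc ?leq_subr // (@coef_mul_trunc n) // leq_subr.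
- have iN : (i <= n)%N by rewrite -ltnS.
  by congr (_ * _); rewrite coef_trunc // (coef_mul_trunc _ _ iN).
Qed.
Fact fps_mulC : commutative fps_mul.
Proof.
by move=> A B; apply: fpsP => n; rewrite 2?(@coef_mul_trunc n) // mulrC.
Qed.
Fact fps_mul1 : left_id (fps_const 1) fps_mul.
Proof.
move=> A; apply: fpsP => n /=;
  rewrite big_ord_recl /= mul1r subn0 big1 ?addr0 //.
by move=> i _; rewrite mul0r.
Qed.
Fact fps_mulDl : left_distributive fps_mul fps_add.
Proof.
move=> A B C; apply: fpsP => n /=; rewrite -big_split /=.
by apply: eq_bigr => i _; rewrite mulrDl.
Qed.
Fact fps_1_neq0 : fps_const 1 != 0.
Proof. by apply/eqP => /(congr1 (fun A => coef A 0)). Qed.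

HB.instance Definition _ := GRing.Zmodule_isComNzRing.Build fps
  fps_mulA fps_mulC fps_mul1 fps_mulDl fps_1_neq0.

Lemma coefD A B n : coef (A + B) n = coef A n + coef B n. Proof. by []. Qed.
Lemma coefN A n : coef (- A) n = - coef A n. Proof. by []. Qed.
Lemma coef0 n : coef 0 n = 0. Proof. by rewrite /= if_same. Qed.
Lemma coef1 n : coef 1 n = (n == 0%N)%:R. Proof. by case: n. Qed.
Lemma coefMr A B n : coef (A * B) n = \sum_(i < n.+1) coef A i * coef B (n - i).
Proof. by []. Qed.
Lemma coefMn A k n : coef (A *+ k) n = coef A n *+ k.
Proof. by elim: k => [|k IH]; rewrite ?coef0 // !mulrS coefD IH. Qed.
Lemma coef_sum I (r : seq I) (P : pred I) (F : I -> fps) n :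
  coef (\sum_(i <- r | P i) F i) n = \sum_(i <- r | P i) coef (F i) n.
Proof. by elim/big_rec2: _ => [|i x y _ <-]; rewrite ?coef0 // coefD. Qed.

Definition qX : fps := Fps (fun n => (n == 1)%N%:R).

Lemma coef_qX A n : coef (qX * A) n = if n is k.+1 then coef A k else 0.
Proof.
rewrite coefMr; case: n => [|n]; first by rewrite big_ord1 mul0r.
rewrite big_ord_recl /= mul0r add0r big_ord_recl /= mul1r subSS subn0.
by rewrite big1 ?addr0 // => i _; rewrite mul0r.
Qed.

Lemma coef_qXn A k n :
  coef (qX ^+ k * A) n = if (k <= n)%N then coef A (n - k) else 0.
Proof.
elim: k n => [|k IH] n; first by rewrite mul1r subn0.
by rewrite exprS -mulrA coef_qX; case: n => // n; rewrite IH.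
Qed.

Lemma coef_qXn1 k n : coef (qX ^+ k) n = (n == k)%:R.
Proof.
rewrite -[_ ^+ _]mulr1 coef_qXn coef1.
by case: (ltngtP n k) => [//|h|->]; rewrite ?subnn // subn_eq0 leqNgt h.
Qed.

Definition bis0 A := Fps (fun n => coef A n.*2).
Definition bis1 A := Fps (fun n => coef A n.*2.+1).
Definition sub2 A := Fps (fun n => if odd n then 0 else coef A n./2).
Definition alt A := Fps (fun n => (-1) ^+ n * coef A n).

Lemma bisP A B : bis0 A = bis0 B -> bis1 A = bis1 B -> A = B.
Proof.
move=> /(congr1 coef) e0 /(congr1 coef) e1; apply: fpsP => n.
rewrite -(odd_double_half n); case: (odd n).
  exact: (congr1 (@^~ n./2) e1).
exact: (congr1 (@^~ n./2) e0).
Qed.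

Lemma sum_parity (f : nat -> int) n :
  \sum_(i < n.*2) f i = \sum_(i < n) f i.*2 + \sum_(i < n) f i.*2.+1.
Proof.
elim: n => [|n IH]; first by rewrite !big_ord0.
by rewrite doubleS !big_ord_recr /= IH !addrA; ring.
Qed.

Fact bis0_zmod_morphism : zmod_morphism bis0.
Proof. by move=> A B; exact: fpsP. Qed.
Fact bis1_zmod_morphism : zmod_morphism bis1.
Proof. by move=> A B; exact: fpsP. Qed.
HB.instance Definition _ := GRing.isZmodMorphism.Build fps fps bis0
  bis0_zmod_morphism.
HB.instance Definition _ := GRing.isZmodMorphism.Build fps fps bis1
  bis1_zmod_morphism.

Lemma bis01 : bis0 1 = 1.
Proof. by apply: fpsP => n; rewrite /= double_eq0. Qed.
Lemma bis11 : bis1 1 = 0.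
Proof. by apply: fpsP => n; rewrite /= if_same. Qed.

(** Two odd exponents 2i+1 and 2j+1 add up to 2(i+j+1), whence the extra factor [qX]. *)
Lemma bis0M A B : bis0 (A * B) = bis0 A * bis0 B + qX * (bis1 A * bis1 B).
Proof.
apply: fpsP => n; rewrite -[LHS]/(coef (A * B) n.*2) coefMr coefD coef_qX.
rewrite big_ord_recr coefMr big_ord_recr !subnn addrAC; congr (_ + _).
rewrite (sum_parity (fun i => coef A i * coef B (n.*2 - i))).
congr (_ + _).
  by apply: eq_bigr => i _; rewrite /= doubleB.
case: n => [|n]; first by rewrite big_ord0.
rewrite coefMr; apply: eq_bigr => i _ /=; congr (_ * coef B _).
by rewrite doubleB; have := ltn_ord i; lia.
Qed.

Lemma bis1M A B : bis1 (A * B) = bis0 A * bis1 B + bis1 A * bis0 B.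
Proof.
apply: fpsP => n; rewrite -[LHS]/(coef (A * B) n.*2.+1) coefMr coefD -doubleS.
rewrite (sum_parity (fun i => coef A i * coef B (n.*2.+1 - i))).
by congr (_ + _); apply: eq_bigr => i _ /=; congr (_ * coef B _);
  rewrite doubleB; have := ltn_ord i; lia.
Qed.

Lemma bis0V A : bis0 (sub2 A) = A.
Proof. by apply: fpsP => n /=; rewrite odd_double doubleK. Qed.
Lemma bis1V A : bis1 (sub2 A) = 0.
Proof. by apply: fpsP => n /=; rewrite odd_double if_same. Qed.
Lemma bis0X : bis0 qX = 0.
Proof. by apply: fpsP => n /=; rewrite if_same; case: n. Qed.
Lemma bis1X : bis1 qX = 1.
Proof. by apply: fpsP => n /=; rewrite eqSS double_eq0; case: n. Qed.

Fact sub2_zmod_morphism : zmod_morphism sub2.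
Proof.
by move=> A B; apply: bisP; rewrite raddfB /= !(bis0V, bis1V) ?subr0.
Qed.
HB.instance Definition _ := GRing.isZmodMorphism.Build fps fps sub2
  sub2_zmod_morphism.
Fact sub2_monoid_morphism : monoid_morphism sub2.
Proof.
split; first by apply: bisP; rewrite !(bis0V, bis1V, bis01, bis11).
move=> A B; apply: bisP;
  by rewrite ?bis0M ?bis1M !(bis0V, bis1V) ?mul0r !mulr0 addr0.
Qed.
HB.instance Definition _ := GRing.isMonoidMorphism.Build fps fps sub2
  sub2_monoid_morphism.

Fact alt_zmod_morphism : zmod_morphism alt.
Proof. by move=> A B; apply: fpsP => n /=; rewrite mulrBr. Qed.
HB.instance Definition _ := GRing.isZmodMorphism.Build fps fps alt
  alt_zmod_morphism.
Fact alt_monoid_morphism : monoid_morphism alt.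
Proof.
split=> [|A B]; apply: fpsP => n /=; first by case: n => //= n; rewrite mulr0.
rewrite mulr_sumr; apply: eq_bigr => i _.
have /subnKC {1}<- : (i <= n)%N by rewrite -ltnS.
by rewrite exprD; ring.
Qed.
HB.instance Definition _ := GRing.isMonoidMorphism.Build fps fps alt
  alt_monoid_morphism.

Lemma sub2_X : sub2 qX = qX ^+ 2.
Proof.
apply: bisP; rewrite expr2 !(bis0V, bis1V, bis0M, bis1M, bis0X, bis1X).
  by rewrite mul0r add0r !mulr1.
by rewrite mul0r mulr0 addr0.
Qed.
Lemma altX : alt qX = - qX.
Proof. by apply: fpsP => -[|[|n]] //=; rewrite ?mulr0 ?oppr0. Qed.
Lemma altV A : alt (sub2 A) = sub2 A.
Proof.
by apply: fpsP => n /=; rewrite -signr_odd; case: odd; rewrite ?mulr0 ?mul1r.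
Qed.
Lemma altK : involutive alt.
Proof.
move=> A; apply: fpsP => n /=.
by rewrite mulrA -exprD addnn -signr_odd odd_double mul1r.
Qed.

End PowerSeries.

(** * Agreement of series up to a given order *)

Section Truncation.
Local Open Scope ring_scope.
Implicit Types A B C : fps.

Definition eqX N A B := forall n, (n <= N)%N -> coef A n = coef B n.

Lemma eqX_trans N B A C : eqX N A B -> eqX N B C -> eqX N A C.
Proof. by move=> h k n nN; rewrite h // k. Qed.

Lemma eqX_sym N A B : eqX N A B -> eqX N B A.
Proof. by move=> h n nN; rewrite h. Qed.

Lemma eqX_le N N' A B : (N' <= N)%N -> eqX N A B -> eqX N' A B.
Proof. by move=> le h n nN; apply: h; apply: leq_trans le. Qed.

Lemma eqX_fps A B : (forall N, eqX N A B) -> A = B.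
Proof. by move=> h; apply: fpsP => n; apply: (h n). Qed.

Lemma eqXM N A A' B B' : eqX N A A' -> eqX N B B' -> eqX N (A * B) (A' * B').
Proof.
move=> hA hB n nN; rewrite !coefMr; apply: eq_bigr => i _.
have iN : (i <= n)%N by rewrite -ltnS.
by rewrite hA ?(leq_trans iN) // hB // (leq_trans (leq_subr _ _)).
Qed.

Lemma eqX_prod N (I : Type) (r : seq I) (P : pred I) (F G : I -> fps) :
  (forall i, P i -> eqX N (F i) (G i)) ->
  eqX N (\prod_(i <- r | P i) F i) (\prod_(i <- r | P i) G i).
Proof. by move=> h; apply: big_ind2 => // *; apply: eqXM. Qed.

Lemma eqX_alt N A B : eqX N A B -> eqX N (alt A) (alt B).
Proof. by move=> h n nN /=; rewrite h. Qed.

Lemma eqX_sub2 N A B : eqX N A B -> eqX N.*2.+1 (sub2 A) (sub2 B).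
Proof.
move=> h n nN /=; case: odd; rewrite ?h //.
by have := half_leq nN; rewrite /= uphalf_double.
Qed.

(** Multiplication by a series with constant term 1 is unitriangular on the coefficients, so strong
    induction on the index cancels it. *)
Lemma eqX_cancel N C A B :
  coef C 0 = 1 -> eqX N (A * C) (B * C) -> eqX N A B.
Proof.
move=> C1 h; suff z D : eqX N (D * C) 0 -> eqX N D 0.
  move=> n nN; apply/eqP; rewrite -subr_eq0 -coefN -coefD -(coef0 n).
  apply/eqP; apply: z => // k kN.
  by rewrite mulrBl coefD coefN h // subrr coef0.
move=> hD n; have [k] := ubnP n; elim: k n => // k IH n nk nN.
have := hD n nN; rewrite coefMr big_ord_recr /= subnn C1 mulr1 big1 ?add0r //.
move=> i _; have := ltn_ord i => iN.
by rewrite IH ?coef0 ?mul0r //;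
  [exact: leq_trans iN _ | exact: leq_trans (ltnW iN) nN].
Qed.

Lemma eqX_mulX k A : eqX k (qX ^+ k.+1 * A) 0.
Proof. by move=> n nk; rewrite coef_qXn ltnNge nk /= if_same. Qed.

End Truncation.

(** * Theta series, Gauss's product for phi(-q), and phi(q) phi(-q) = phi(-q^2)^2 *)

Section Theta.
Local Open Scope ring_scope.

(** Only positive roots are tried, so 0 is not counted: [phi] then has constant term 1 and counts
    each positive square twice, once for each sign of the root. *)
Definition is_square n := has (fun k => k ^ 2 == n)%N (iota 1 n).

Lemma squareP n : reflect (exists2 k, (0 < k)%N & (k ^ 2)%N = n) (is_square n).
Proof.
apply: (iffP hasP) => [[k]|[k k0 e]].
  by rewrite mem_iota => /andP[k0 _] /eqP; exists k.
by exists k; rewrite ?e // mem_iota k0 add1n ltnS -e -{1}[k]expn1 leq_pexp2l.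
Qed.

Definition theta : fps := Fps (fun n => (is_square n)%:R).
Definition phi : fps := 1 + theta *+ 2.
Definition phiN : fps := alt phi.
(* A number n is triangular when 8n+1 is a square. *)
Definition psi : fps := Fps (fun n => (is_square (8 * n + 1))%:R).

Lemma bis0_theta : bis0 theta = sub2 theta.
Proof.
apply: fpsP => n /=.
have even_sq k : (k ^ 2 = n.*2)%N -> exists2 j, k = j.*2 & n = (j ^ 2).*2.
  move=> e; have ok : odd k = false.
    by have := congr1 odd e; rewrite odd_double oddX.
  exists k./2; first by rewrite even_halfK ?ok.
  by move: e; rewrite -{1}(even_halfK (negbT ok)); lia.
case: ifP => on.
  by case: squareP => // -[k _ /even_sq[j _ en]]; rewrite en odd_double in on.
congr (_%:R); congr nat_of_bool; apply/squareP/squareP => -[k k0 e].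
  have [j ej ->] := even_sq k e; exists j; last by rewrite doubleK.
  by move: k0; rewrite ej double_gt0.
exists k.*2; first by rewrite double_gt0.
by rewrite -(even_halfK (negbT on)) -e; lia.
Qed.

(** An odd square is 8T + 1 with T triangular, so 2n + 1 is a square only if n = 4T; this accounts
    for the two [sub2]. *)
Lemma bis1_theta : bis1 theta = sub2 (sub2 psi).
Proof.
apply: fpsP => n /=.
have odd_sq k : (k ^ 2 = n.*2.+1)%N -> exists j, n = j.*2.*2.
  move=> e; have ok : odd k.
    by have := congr1 odd e; rewrite oddX /= odd_double.
  have [j ej] : exists j, (k./2 * k./2.+1)%N = j.*2.
    exists (k./2 * k./2.+1)./2; rewrite even_halfK //.
    by rewrite oddM /= andbN.
  by exists j; move: e; rewrite -(odd_double_half k) ok; lia.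
case: ifP => on.
  by case: squareP => // -[k _ /odd_sq[j en]]; rewrite en odd_double in on.
case: ifP => on2.
  case: squareP => // -[k _ /odd_sq[j en]].
  by rewrite en doubleK odd_double in on2.
congr (is_square _)%:R.
by rewrite -{1}(even_halfK (negbT on)) -{1}(even_halfK (negbT on2)); lia.
Qed.

Definition Gp n : fps := \prod_(0 <= i < n) (1 + qX ^+ i.+1).
Definition Fp s n : fps := \prod_(s <= i < n) (1 - qX ^+ i.+1).
(** The partial sums of phi(-q). *)
Definition theta_part n : fps :=
  1 + (\sum_(i < n) (-1) ^+ i.+1 * qX ^+ (i.+1 ^ 2)) *+ 2.

Lemma coef_signM A k n : coef ((-1) ^+ k * A) n = (-1) ^+ k * coef A n.
Proof. by rewrite -!(signr_odd _ k); case: odd; rewrite ?mulN1r ?mul1r. Qed.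

Lemma coef_1D2 A n : coef (1 + A *+ 2) n = (n == 0%N)%:R + coef A n *+ 2.
Proof. by rewrite coefD coef1 coefMn. Qed.

Lemma phiN_part n : eqX n phiN (theta_part n).
Proof.
move=> k kn; rewrite /theta_part -[LHS]/((-1) ^+ k * coef phi k) /phi.
rewrite !coef_1D2 coef_sum mulrDr [X in _ + X]mulrnAr; congr (_ + _);
  last congr (_ *+ _).
  by case: k kn => [|k] _; rewrite ?mulr1 ?mulr0.
under eq_bigr do rewrite coef_signM coef_qXn1.
rewrite /=; case: squareP => [[s s0 es]|nsq]; last first.
  rewrite mulr0 big1 // => i _; case: eqP => [e|_]; last by rewrite mulr0.
  by case: nsq; exists i.+1.
have sn : (s.-1 < n)%N.
  by rewrite prednK // (leq_trans _ kn) // -es -{1}[s]expn1 leq_pexp2l.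
rewrite (bigD1 (Ordinal sn)) //= prednK // es eqxx !mulr1 big1 ?addr0 => [|i].
  (* A root s and its square have the same parity, so q -> -q produces the sign (-1)^s. *)
  by rewrite -signr_odd -es oddX /= signr_odd.
rewrite -val_eqE /= -es eqn_exp2r // => ne.
by rewrite -{1}(prednK s0) eqSS eq_sym (negPf ne) mulr0.
Qed.

Definition shanks_term n j : fps :=
  Fp j.+1 n * Gp j * qX ^+ (j.+1 * n.+1).

(* Shanks' finite form of Gauss's identity. From n to n+1 the terms of the sum
   change by [b j + b j.+1], which telescopes against the signs. *)
Lemma shanks n : Gp n * theta_part n =
  Fp 0 n + (\sum_(j < n) (-1) ^+ j.+1 * shanks_term n j) *+ 2.
Proof.
elim: n => [|n IH].
  by rewrite /Gp /Fp /theta_part !big_nil !big_ord0 !mul0rn !addr0 mulr1.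
pose N := n.+1; set x := qX.
pose b j := Fp j n * Gp j * x ^+ (j.+1 * N).
have step j : (j < n)%N ->
    (1 + x ^+ N) * shanks_term n j = shanks_term N j + (b j + b j.+1).
  move=> jn; rewrite /shanks_term /b /Fp /Gp [in RHS]big_nat_recr //=.
  rewrite (big_ltn jn) (big_nat_recr _ _ _ (leq0n j)) /=.
  have -> : (j.+1 * N.+1 = j.+1 * N + j.+1)%N by lia.
  have -> : (j.+2 * N = j.+1 * N + N)%N by lia.
  by rewrite -/x !exprD; ring.
have tele : \sum_(j < n) (-1) ^+ j.+1 * (b j + b j.+1)
    = - b 0%N + (-1) ^+ n * b n.
  elim: (n) => [|k IHk]; first by rewrite big_ord0; ring.
  by rewrite big_ord_recr /= IHk !exprS; ring.
have E1 : theta_part N = theta_part n + ((-1) ^+ N * x ^+ (N ^ 2)) *+ 2.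
  by rewrite /theta_part big_ord_recr /= mulrnDl addrA.
have E2 : Gp N = Gp n * (1 + x ^+ N) by rewrite /Gp big_nat_recr.
have E3 : Fp 0 N = Fp 0 n * (1 - x ^+ N) by rewrite /Fp big_nat_recr.
have E4 : \sum_(j < n) (-1) ^+ j.+1 * shanks_term n j * (1 + x ^+ N)
   = \sum_(j < n) (-1) ^+ j.+1 * shanks_term N j + (- b 0%N + (-1) ^+ n * b n).
  rewrite -tele -big_split; apply: eq_bigr => j _ /=.
  by rewrite -mulrDr -step //; ring.
rewrite -/N E1 mulrDr E2 -mulrA (mulrC (1 + _)) mulrA IH.
rewrite big_ord_recr /= mulrDl mulrnAl mulr_suml.
have Fkk k : Fp k k = 1 by rewrite /Fp big_geq.
have G0 : Gp 0 = 1 by rewrite /Gp big_geq.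
rewrite E4 E3 /b /shanks_term !Fkk G0 -/x -/N.
have -> : (N * N.+1 = N ^ 2 + N)%N by lia.
have -> : (N * N = N ^ 2)%N by lia.
rewrite mul1n exprD.
rewrite [(-1) ^+ N]exprS; move: (x ^+ (N ^ 2)%N) (x ^+ N) ((-1) ^+ n) => u v w;
  ring.
Qed.

Lemma coefM0 A B : coef (A * B) 0 = coef A 0 * coef B 0.
Proof. by rewrite coefMr big_ord1. Qed.

Lemma coef_alt0 A : coef (alt A) 0 = coef A 0.
Proof. by rewrite /= mul1r. Qed.

Lemma coef_sub2_0 A : coef (sub2 A) 0 = coef A 0.
Proof. by []. Qed.

Lemma coefGp0 n : coef (Gp n) 0 = 1.
Proof.
rewrite /Gp; elim/big_ind: _ => // [A B a b|i _].
  by rewrite coefM0 a b.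
by rewrite coefD coef_qXn1 addr0.
Qed.

(** Gauss's product modulo q^(n+1), with denominators cleared: every term of the error sum in
    [shanks] carries a factor q^(n+1). *)
Lemma gauss n : eqX n (phiN * Gp n) (Fp 0 n).
Proof.
apply: (@eqX_trans _ (theta_part n * Gp n)).
  by apply: eqXM => //; apply: phiN_part.
rewrite mulrC shanks => k kn; rewrite coefD coefMn coef_sum big1 ?addr0 //.
move=> j _; rewrite /shanks_term mulSn exprD.
rewrite (mulrCA (Fp _ _ * _)) (mulrCA _ (qX ^+ n.+1)).
by rewrite eqX_mulX // coef0.
Qed.

(** By [gauss] both sides become products; once denominators are cleared they agree factor by
    factor, and the common cofactor has constant term 1, so it cancels. *)
Lemma phi_phiN : phi * phiN = sub2 phiN ^+ 2.
Proof.
apply: eqX_fps => n; apply: (@eqX_le n.*2); first by rewrite -addnn leq_addr.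
(* Two factors enter at a time: x has an odd exponent and changes sign under [alt], while y has an
   even one and is the image of z by [sub2]. *)
have prods : Fp 0 n.*2 * alt (Fp 0 n.*2) * sub2 (Gp n) ^+ 2
    = Gp n.*2 * alt (Gp n.*2) * sub2 (Fp 0 n) ^+ 2.
  elim: (n) => [|k IH]; first by rewrite /Fp /Gp !big_nil !rmorph1.
  rewrite doubleS /Fp /Gp !(big_nat_recr _ _ _ (leq0n _)) /=.
  rewrite -/(Fp 0 k) -/(Gp k) -/(Fp 0 k.*2) -/(Gp k.*2).
  set x := qX ^+ k.*2.+1; set y := qX ^+ k.*2.+2.
  set z := qX ^+ k.+1.
  have ax : alt x = - x.
    by rewrite rmorphXn /= altX exprNn -signr_odd /= odd_double mulN1r.
  have ay : alt y = y.
    by rewrite rmorphXn /= altX exprNn -signr_odd /= odd_double mul1r.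
  have vy : sub2 z = y by rewrite rmorphXn /= sub2_X -exprM mul2n.
  clearbody x y z; rewrite !(rmorphM, rmorphD, rmorphN, rmorph1) /= ax ay vy.
  transitivity (Fp 0 k.*2 * alt (Fp 0 k.*2) * sub2 (Gp k) ^+ 2 *
    ((1 - x) * (1 + x) * (1 - y) ^+ 2 * (1 + y) ^+ 2)); first by ring.
  by rewrite IH; ring.
have c1 : coef (Gp n.*2 * alt (Gp n.*2) * sub2 (Gp n) ^+ 2) 0 = 1.
  by rewrite expr2 !coefM0 coef_alt0 coef_sub2_0 !coefGp0.
apply: (eqX_cancel c1).
have g2 := @gauss n.*2; have ga := eqX_alt g2;
  rewrite rmorphM /= [alt phiN]altK in ga.
have gs := eqX_le (leqnSn _) (eqX_sub2 (@gauss n)); rewrite rmorphM /= in gs.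
have l := eqXM (eqXM g2 ga) (fun k _ => erefl (coef (sub2 (Gp n) ^+ 2) k)).
have r := eqXM (fun k _ => erefl (coef (Gp n.*2 * alt (Gp n.*2)) k)) (eqXM gs
  gs).
rewrite prods in l; rewrite -expr2 in r.
move: (eqX_trans l (eqX_sym r)).
by congr (eqX _ _ _); ring.
Qed.

End Theta.

(** * Colored overpartitions as coefficients of a finite product *)

Section GeneratingFunction.
Local Open Scope ring_scope.
Variable l : nat.

Definition admissible n (x : 'I_n * bool) (y : 'I_n.+1 * bool) : bool :=
  (y.2 ==> (0 < y.1)%N) && ((0 < y.1)%N && x.2 ==> (l %| x.1.+1)%N).

Definition part_series n (x : 'I_n * bool) : fps :=
  \sum_(y | admissible x y) qX ^+ (x.1.+1 * y.1).

Lemma family_admissible n (p : colored_overpart n) :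
  is_overpart l p = (p \in family (@admissible n)) &&
    (\sum_(x : 'I_n * bool) x.1.+1 * (p x).1 == n)%N.
Proof.
rewrite /is_overpart (pair_bigA _ (fun (i : 'I_n) c => i.+1 * mult p i c)%N) /=
  andbC.
rewrite (eq_bigr (fun x : 'I_n * bool => x.1.+1 * (p x).1)%N); last by case.
congr (_ && _); apply/andP/familyP => [[/forallP ho /forallP hd] [i c]|h].
  apply/andP; split; first exact: (forallP (ho i) c).
  by case: c; [rewrite andbT; apply: hd | rewrite andbF].
split; apply/forallP => i; last first.
  by have /andP[_ /=] := h (i, true); rewrite andbT.
by apply/forallP => c; have /andP[] := h (i, c).
Qed.

(** Expanding the product of sums chooses an admissible value for every colored part, that is, an
    element of [colored_overpart n]; the exponent of q is its weight. *)
Lemma coef_prod_part_series n :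
  coef (\prod_(x : 'I_n * bool) part_series x) n = (pbar l n)%:R :> int.
Proof.
rewrite /part_series (bigA_distr_big_dep (@admissible n)) coef_sum.
rewrite /pbar -sum1dep_card natr_sum.
rewrite [RHS](eq_bigl _ _ (@family_admissible n)) [RHS]big_mkcondr /=.
by apply: eq_bigr => p _; rewrite prodrXr coef_qXn1 eq_sym; case: eqP.
Qed.

Definition GL n : fps :=
  \prod_(0 <= i < n) (if (l %| i.+1)%N then 1 + qX ^+ i.+1 else 1).
Definition FL n : fps :=
  \prod_(0 <= i < n) (if (l %| i.+1)%N then 1 - qX ^+ i.+1 else 1).

(** Multiplicity 0 excludes an overline, while each positive multiplicity occurs once overlined and
    once not, hence the factor 2. *)
Lemma part_seriesE n (i : 'I_n) c : part_series (i, c) =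
  if c && ~~ (l %| i.+1)%N then 1 else
  1 + (\sum_(m < n) qX ^+ (i.+1 * m.+1)) *+ 2.
Proof.
rewrite /part_series big_mkcond /=.
rewrite -(pair_bigA _ (fun m o => if admissible (i, c) (m, o)
  then qX ^+ (i.+1 * m) else 0)) /= big_ord_recl big_bool /= muln0 add0r.
under eq_bigr => m _ do rewrite big_bool /admissible /= !mulnS.
case: ifP => [/andP[-> /negPf->]|h].
  by rewrite big1 ?addr0 // => m _; rewrite add0r.
rewrite -sumrMnl; congr (_ + _); apply: eq_bigr => m _.
by rewrite mulr2n mulnS; case: (c) (_ %| _)%N h => [] [].
Qed.

(** The geometric sum telescopes and leaves the error 2 q^((i+1)(n+1)), whose exponent exceeds n. *)
Lemma part_series_mul n (i : 'I_n) c : eqX n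
  (part_series (i, c) * (if c && ~~ (l %| i.+1)%N then 1 else 1 - qX ^+ i.+1))
  (if c && ~~ (l %| i.+1)%N then 1 else 1 + qX ^+ i.+1).
Proof.
rewrite part_seriesE; case: ifP => _; first by rewrite mulr1.
have geom k : (1 + (\sum_(m < k) qX ^+ (i.+1 * m.+1)) *+ 2) * (1 - qX ^+ i.+1) =
    1 + qX ^+ i.+1 - (qX ^+ (i.+1 * k.+1)) *+ 2.
  elim: k => [|k IH]; first by rewrite big_ord0 muln1; ring.
  rewrite big_ord_recr /= mulrnDl addrA mulrDl IH (mulnS _ k.+1) exprD.
  by move: (qX ^+ i.+1) (qX ^+ (i.+1 * k.+1)) => u v; ring.
rewrite geom.
move=> k kn; rewrite coefD coefN coefMn coef_qXn1.
suff /negPf-> : (k != i.+1 * n.+1)%N by rewrite subr0.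
by rewrite neq_ltn mulSn addSn ltnS (leq_trans kn) // leq_addr.
Qed.

Lemma pbar_product n :
  eqX n (\prod_(x : 'I_n * bool) part_series x * (Fp 0 n * FL n))
    (Gp n * GL n).
Proof.
pose sgnd (f : fps -> fps) n (x : 'I_n * bool) :=
  if x.2 && ~~ (l %| x.1.+1)%N then 1 else f (qX ^+ x.1.+1).
(* The color [false] contributes the full product, the color [true] only the factors at multiples of
   l. *)
have split_prod f : \prod_(x : 'I_n * bool) sgnd f n x =
    \prod_(0 <= i < n) f (qX ^+ i.+1) *
    \prod_(0 <= i < n) (if (l %| i.+1)%N then f (qX ^+ i.+1) else 1).
  rewrite -(pair_bigA _ (fun i c => sgnd f n (i, c))) /= !big_mkord -big_split
    /=.
  apply: eq_bigr => i _; rewrite big_bool /sgnd /= mulrC.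
  by case: ifP => [/negPf->|/negbFE->].
rewrite /Fp /FL /Gp /GL -(split_prod (fun x => 1 - x)) -(split_prod (+%R 1)).
rewrite -big_split; apply: eqX_prod => -[i c] _; exact: part_series_mul.
Qed.

End GeneratingFunction.

(** * The generating function for l = 8 *)

Section Overpartitions.
Local Open Scope ring_scope.

Definition sub8 A := sub2 (sub2 (sub2 A)).

Lemma coef_sub8_0 A : coef (sub8 A) 0 = coef A 0.
Proof. by []. Qed.

Lemma sub2_Xn k : sub2 (qX ^+ k) = qX ^+ (2 * k).
Proof. by rewrite rmorphXn /= sub2_X -exprM. Qed.

Lemma sub8_X k : sub8 (qX ^+ k) = qX ^+ (8 * k).
Proof. by rewrite /sub8 !sub2_Xn !mulnA. Qed.

Lemma sub8_prod n (f : fps -> fps) : (forall k, sub8 (f (qX ^+ k)) = f (qX ^+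
  (8 * k))) ->
  \prod_(0 <= i < n) (if (8 %| i.+1)%N then f (qX ^+ i.+1) else 1) =
  sub8 (\prod_(0 <= i < n %/ 8) f (qX ^+ i.+1)).
Proof.
move=> hf; elim: n => [|n IH]; first by rewrite !big_geq // /sub8 !rmorph1.
rewrite big_nat_recr //= {}IH divnS //; case: ifP => [d|_];
  last by rewrite mulr1.
rewrite add1n big_nat_recr //= /sub8 !rmorphM /= -!/(sub8 _) hf;
  congr (_ * f (_ ^+ _)).
by move: (divnK d); rewrite divnS // d add1n mulnC.
Qed.

Definition P8 : fps := Fps (fun n => (pbar 8 n)%:R).

Lemma pbar8_gf : P8 * (phiN * sub8 phiN) = 1.
Proof.
pose PN N := \prod_(x : 'I_N * bool) part_series 8 x.
have GL8 n : GL 8 n = sub8 (Gp (n %/ 8)).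
  rewrite /GL (@sub8_prod _ (+%R 1)) // => k.
  by rewrite /sub8 !(rmorphD, rmorph1) /= -!/(sub8 _) sub8_X.
have FL8 n : FL 8 n = sub8 (Fp 0 (n %/ 8)).
  rewrite /FL (@sub8_prod _ (fun x => 1 - x)) // => k.
  by rewrite /sub8 !(rmorphB, rmorph1) /= -!/(sub8 _) sub8_X.
have inv N : eqX N (PN N * (phiN * sub8 phiN)) 1.
  have c1 : coef (Gp N * GL 8 N) 0 = 1.
    by rewrite coefM0 GL8 coef_sub8_0 !coefGp0.
  apply: (eqX_cancel c1); rewrite mul1r.
  apply: (eqX_trans _ (@pbar_product 8 N)).
  rewrite -mulrA; apply: eqXM => //.
  rewrite mulrACA; apply: eqXM; first exact: gauss.
  rewrite GL8 FL8 /sub8 -!rmorphM.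
  apply: eqX_le (eqX_sub2 (eqX_sub2 (eqX_sub2 (@gauss (N %/ 8))))).
  (* Three doublings raise the order N/8 to 8(N/8) + 7, which is at least N. *)
  have := ltn_pmod N (isT : 0 < 8)%N; have := divn_eq N 8.
  by rewrite -!mul2n; lia.
(* [PN N] changes with N, but up to order N it is the inverse of phi(-q) phi(-q^8); its coefficient
   at n therefore equals that of [PN n], which counts the overpartitions of n. *)
have PN_eq N n : (n <= N)%N -> coef (PN N) n = coef P8 n.
  move=> nN; rewrite -[RHS]/((pbar 8 n)%:R) -coef_prod_part_series.
  have c1 : coef (phiN * sub8 phiN) 0 = 1.
    by rewrite coefM0 coef_sub8_0 coef_alt0 coef_1D2.
  apply: (eqX_cancel c1) (leqnn n); apply: eqX_trans (eqX_sym (@inv n)).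
  exact: eqX_le nN (@inv N).
apply: eqX_fps => N; apply: eqX_trans (@inv N).
by apply: eqXM => // n nN; rewrite PN_eq.
Qed.

End Overpartitions.

Local Notation V := sub2.

(** * Relations between phi and psi, and the product form of the generating function *)

Section ThetaRelations.
Local Open Scope ring_scope.

Lemma bis0_phi : bis0 phi = V phi.
Proof. by rewrite /phi !(raddfD, raddfMn) /= bis01 bis0_theta rmorph1. Qed.

Lemma bis1_phi : bis1 phi = V (V psi) *+ 2.
Proof. by rewrite /phi raddfD raddfMn /= bis11 bis1_theta add0r. Qed.

Lemma bis0_alt A : bis0 (alt A) = bis0 A.
Proof. by apply: fpsP => n /=; rewrite -signr_odd odd_double mul1r. Qed.

Lemma bis1_alt A : bis1 (alt A) = - bis1 A.
Proof. by apply: fpsP => n /=; rewrite -signr_odd /= odd_double mulN1r. Qed.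

Lemma bis0MV A B : bis0 (A * V B) = bis0 A * B.
Proof. by rewrite bis0M bis0V bis1V !mulr0 addr0. Qed.

Lemma bis1MV A B : bis1 (A * V B) = bis1 A * B.
Proof. by rewrite bis1M bis0V bis1V mulr0 add0r. Qed.

Lemma phiNE : phiN = V (V phi) *+ 2 - phi.
Proof.
apply: bisP; rewrite !(raddfB, raddfMn) /= ?bis0_alt ?bis1_alt ?bis0V ?bis1V.
  by rewrite bis0_phi mulr2n addrK.
by rewrite mul0rn add0r.
Qed.

(** The even part of [phi_phiN] gives phi(-q)^2 = phi(q^2)^2 - 4q psi(q^4)^2; replacing q by -q
    yields the claim. *)
Lemma phi_sq : phi ^+ 2 = V phi ^+ 2 + qX * V (V psi) ^+ 2 *+ 4.
Proof.
have h : V phi ^+ 2 - qX * V (V psi) ^+ 2 *+ 4 = phiN ^+ 2.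
  move: (congr1 bis0 phi_phiN); rewrite bis0M bis0_alt bis1_alt -rmorphXn bis0V.
  by move=> <-; rewrite bis0_phi bis1_phi; ring.
rewrite -[phi ^+ 2]/((fun A => A ^+ 2) phi) -{1}[phi]altK /= -[alt phi]/phiN.
rewrite -rmorphXn -h !(rmorphB, rmorphMn, rmorphM, rmorphXn) /= !altV altX.
by ring.
Qed.

Lemma bis0_phi2 : bis0 (phi ^+ 2) = phi ^+ 2.
Proof.
rewrite {2}phi_sq expr2 bis0M bis0_phi bis1_phi; ring.
Qed.

Lemma bis1_phi2 : bis1 (phi ^+ 2) = V (phi * V psi) *+ 4.
Proof. by rewrite expr2 bis1M bis0_phi bis1_phi rmorphM /=; ring. Qed.

(** The odd part of phi^2 is computed both by the product rule and from [phi_sq]; a common factor 4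
    is cancelled. *)
Lemma psi_sq : psi ^+ 2 = phi * V psi.
Proof.
have h : V (psi ^+ 2) *+ 4 = V (phi * V psi) *+ 4.
  rewrite -bis1_phi2 phi_sq raddfD raddfMn -!rmorphXn /= bis1V add0r.
  by rewrite bis1MV bis1X mul1r.
have := congr1 bis0 h; rewrite !raddfMn /= !bis0V => {}h.
apply: fpsP => n; have := congr1 (coef^~ n) h; rewrite !coefMn.
by move: (coef _ n) (coef _ n) => a b; lia.
Qed.

Lemma bis0_phi4 : bis0 (phi ^+ 4) = phi ^+ 4 + qX * V psi ^+ 4 *+ 16.
Proof.
rewrite (exprM phi 2 2) expr2 bis0M bis0_phi2 bis1_phi2 -psi_sq rmorphXn /=.
by ring.
Qed.

Lemma bis1_phi4 : bis1 (phi ^+ 4) = phi ^+ 2 * V psi ^+ 2 *+ 8.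
Proof.
rewrite (exprM phi 2 2) expr2 bis1M bis0_phi2 bis1_phi2 -psi_sq rmorphXn /=.
by ring.
Qed.

(** The inverse of phi(-q), obtained from the generating function by removing the factor 1 /
    phi(-q^8). *)
Definition phiNi : fps := P8 * sub8 phiN.

Lemma phiNK : phiN * phiNi = 1.
Proof. by rewrite /phiNi mulrCA pbar8_gf. Qed.

(** This is [phi_phiN] divided through: 1 / phi(-q) = phi(q) / phi(-q^2)^2. Iterating it pushes the
    inverse into ever higher powers of q. *)
Lemma phiNiE : phiNi = phi * V (phiNi ^+ 2).
Proof.
rewrite -[LHS]mulr1 -(rmorph1 V) -[in LHS](expr1n _ 2) -phiNK exprMn rmorphM /=.
rewrite [V (phiN ^+ 2)]rmorphXn /= -phi_phiN.
transitivity (phiN * phiNi * (phi * V (phiNi ^+ 2))); first by ring.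
by rewrite phiNK mul1r.
Qed.

Lemma P8_phiNi : P8 = phiNi * sub8 phiNi.
Proof.
have : sub8 phiN * sub8 phiNi = 1 by rewrite /sub8 -!rmorphM phiNK !rmorph1.
by rewrite /phiNi -mulrA => ->; rewrite mulr1.
Qed.

Lemma P8E : P8 = phi * V (phi ^+ 2 * V (phi ^+ 4 * V (phiNi ^+ 9))).
Proof.
have sq k : phiNi ^+ k = phi ^+ k * V (phiNi ^+ (2 * k)).
  by rewrite {1}phiNiE exprMn -(rmorphXn V) -exprM.
have e1 : phiNi = phi * V (phi ^+ 2 * V (phi ^+ 4 * V (phiNi ^+ 8))).
  by rewrite {1}phiNiE (sq 2) (sq 4).
rewrite P8_phiNi {1}e1 -mulrA /sub8 -(rmorphM V) -mulrA -(rmorphM V) -mulrA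
  -(rmorphM V).
by rewrite (exprSr phiNi 8).
Qed.

End ThetaRelations.

(** * Divisibility by 3 *)

Section Mod3.
Local Open Scope ring_scope.

Definition supp3 A := forall n, ~~ (3 %| n)%N -> (3 %| coef A n)%Z.
Definition off2 A := forall n, (n %% 3 = 2)%N -> (3 %| coef A n)%Z.

Lemma supp3M A B : supp3 A -> supp3 B -> supp3 (A * B).
Proof.
move=> hA hB n n3; rewrite coefMr; apply: rpred_sum => i _.
have [i3|] := boolP (3 %| i)%N; last by move=> i3; apply: dvdz_mulr; apply: hA.
by apply: dvdz_mull; apply: hB; move: i3 n3 (ltn_ord i); lia.
Qed.

Lemma off2M A B : supp3 A -> off2 B -> off2 (A * B).
Proof.
move=> hA hB n n3; rewrite coefMr; apply: rpred_sum => i _.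
have [i3|] := boolP (3 %| i)%N; last by move=> i3; apply: dvdz_mulr; apply: hA.
apply: dvdz_mull; apply: hB; have : (i <= n)%N by rewrite -ltnS.
by move: i3 n3; lia.
Qed.

Lemma supp3V A : supp3 A -> supp3 (V A).
Proof.
move=> hA n n3 /=; case: ifP => // on; apply: hA.
by move: n3; rewrite -{1}(even_halfK (negbT on)) -mul2n Gauss_dvdr.
Qed.

(** With [delta] = q d/dq one has delta(A^3) = 3 A^2 delta(A), so 3 divides n times the coefficient
    of q^n in A^3. *)
Lemma supp3_cube A : supp3 (A ^+ 3).
Proof.
pose delta B := Fps (fun n => coef B n *+ n).
have deltaM B C : delta (B * C) = delta B * C + B * delta C.
  apply: fpsP => n; rewrite coefD !coefMr -big_split /= -sumrMnl.
  apply: eq_bigr => i _ /=; have iN : (i <= n)%N by rewrite -ltnS.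
  by rewrite mulrnAl mulrnAr -mulrnDr subnKC.
move=> n n3; have : coef (delta (A ^+ 3)) n = coef (A ^+ 2 * delta A) n *+ 3.
  by rewrite -coefMn !exprS expr0 mulr1 !deltaM; congr (coef _ n); ring.
move=> e0; have e : coef (A ^+ 3) n * n%:R = coef (A ^+ 2 * delta A) n * 3%:R.
  by rewrite !mulr_natr -e0.
have : (3 %| coef (A ^+ 3) n * n%:R)%Z by rewrite e dvdz_mull.
by rewrite natz Gauss_dvdzl // coprimezE /= prime_coprime.
Qed.

Lemma phiN_off2 : off2 phiN.
Proof.
move=> n n3; rewrite -[coef phiN n]/((-1) ^+ n * coef phi n).
have -> : coef phi n = 0; last by rewrite mulr0 dvdz0.
rewrite /phi coef_1D2 /=; case: squareP => [[k _ ek]|_].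
  by move: n3; rewrite -ek -modnXm;
    case: (k %% 3)%N (ltn_pmod k (isT : 0 < 3)%N) => [|[|[|?]]].
by case: n n3.
Qed.

Lemma supp3_psi_phiN : supp3 (psi * phiN ^+ 2).
Proof.
set h := _ * _; have e : h ^+ 2 = V h * phiN ^+ 3.
  rewrite /h exprMn psi_sq rmorphM rmorphXn /= -phi_phiN; ring.
have h0 : coef h 0 = 1.
  by rewrite /h expr2 !coefM0 coef_alt0 coef_1D2.
move=> n; have [k] := ubnP n; elim: k n => // k IH n nk n3.
have n0 : (0 < n)%N by case: n n3 {nk}.
(* If i is prime to 3, the induction hypothesis applies at i/2 < n; otherwise n - i is prime to 3
   and the cube is divisible by 3 there. *)
have hl : (3 %| coef (V h * phiN ^+ 3) n)%Z.
  rewrite coefMr; apply: rpred_sum => i _;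
    have iN : (i <= n)%N by rewrite -ltnS.
  have [i3|i3] := boolP (3 %| i)%N.
    by apply: dvdz_mull; apply: supp3_cube; move: i3 n3 iN; lia.
  apply: dvdz_mulr; rewrite /=; case: ifP => // oi; apply: IH.
    by move: (even_halfK (negbT oi)); lia.
  by move: i3; rewrite -{1}(even_halfK (negbT oi)) -mul2n Gauss_dvdr.
(* The two end terms of the square give twice the coefficient of q^n in h; in every middle term one
   of the two indices is prime to 3 and smaller than n. *)
move: hl; rewrite -e expr2 coefMr big_ord_recl subn0 (h0 : coef h (@ord0 n) =
  1) mul1r.
case: n n0 nk n3 => // n _ nk n3; rewrite big_ord_recr subnn h0 mulr1.
set mid := \big[_/_]_(i < n) _ => hl.
have hm : (3 %| mid)%Z.
  apply: rpred_sum => i _; have := ltn_ord i => iN.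
  have [i3|i3] := boolP (3 %| i.+1)%N.
    by apply: dvdz_mull; apply: IH; rewrite /= /bump /=; move: i3 n3; lia.
  by apply: dvdz_mulr; apply: IH; rewrite /= /bump /=; move: i3 nk iN; lia.
have : (3 %| coef h n.+1 * 2)%Z; last by rewrite Gauss_dvdzl.
have := rpredB hl hm; congr (_ %| _)%Z.
rewrite -[coef h (lift _ _)]/(coef h n.+1) /=; ring.
Qed.

Lemma pbar8_mod3 n : (3 %| coef P8 (6 * n + 5))%Z.
Proof.
have -> : coef P8 (6 * n + 5) = coef (bis1 P8) (3 * n + 2).
  by rewrite -[RHS]/(coef P8 _); congr coef; lia.
(* Inserting phi(-q) / phi(-q) and the square of phi(-q^4) / phi(-q^4) completes the inverse powers
   to cubes. *)
have -> : bis1 P8 = V (V (psi * phiN ^+ 2)) *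
    (phiNi ^+ 3 * V (V (phiNi ^+ 3))) * phiN *+ 2.
  have -> : bis1 P8 = V (V psi) *+ 2 * (phiNi ^+ 2 * V (V phiNi)).
    by rewrite P8_phiNi {1}phiNiE /sub8 -mulrA -(rmorphM V) bis1MV bis1_phi.
  move: phiNi phiNK => y yK; rewrite !(rmorphM, rmorphXn) /=.
  have hV : V (V phiN) * V (V y) = 1 by rewrite -!(rmorphM V) yK !rmorph1.
  transitivity (V (V psi) * (y ^+ 2 * V (V y)) * (phiN * y) *
    (V (V phiN) * V (V y)) ^+ 2 *+ 2); last by ring.
  by rewrite yK hV; ring.
rewrite coefMn; apply: rpredMn.
apply: (off2M _ phiN_off2); last by lia.
apply: supp3M; first by do 2!apply: supp3V; apply: supp3_psi_phiN.
by apply: supp3M; [|do 2!apply: supp3V]; apply: supp3_cube.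
Qed.

End Mod3.

(** * Congruences between series, and Frobenius modulo 2 *)

Section Congruence.
Local Open Scope ring_scope.

Definition eqm (k : nat) (A B : fps) := exists C, A = B + C *+ k.

Lemma eqm_refl k A : eqm k A A.
Proof. by exists 0; rewrite mul0rn addr0. Qed.

Lemma eqm_trans k B A C : eqm k A B -> eqm k B C -> eqm k A C.
Proof. by move=> [X ->] [Y ->]; exists (Y + X); rewrite mulrnDl addrA. Qed.

Lemma eqmM k A A' B B' : eqm k A A' -> eqm k B B' -> eqm k (A * B) (A' * B').
Proof.
move=> [X ->] [Y ->]; exists (A' * Y + X * B' + X * Y * k%:R).
rewrite -(mulr_natr X) -(mulr_natr Y) -(mulr_natr (_ + _)).
by move: (k%:R : fps) => c; ring.
Qed.

Lemma eqmX k A B e : eqm k A B -> eqm k (A ^+ e) (B ^+ e).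
Proof.
move=> h; elim: e => [|e IH]; first exact: eqm_refl.
by rewrite !exprS; apply: eqmM.
Qed.

Lemma eqm_additive k A B (f : {additive fps -> fps}) :
  eqm k A B -> eqm k (f A) (f B).
Proof. by case=> C ->; exists (f C); rewrite raddfD raddfMn. Qed.

Lemma eqmP k A B : eqm k A B <-> forall n, (k%:Z %| coef A n - coef B n)%Z.
Proof.
split=> [[C -> n]|h].
  rewrite coefD addrC addKr coefMn -mulr_natr natz.
  exact: dvdz_mull.
exists (Fps (fun n => (coef A n - coef B n) %/ k%:Z)%Z); apply: fpsP => n.
by rewrite coefD coefMn -mulr_natr natz divzK // addrC subrK.
Qed.

Lemma bis_decomp A : A = V (bis0 A) + qX * V (bis1 A).
Proof.
apply: bisP; rewrite raddfD /= ?bis0MV ?bis1MV !(bis0V, bis1V, bis0X, bis1X).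
  by rewrite mul0r addr0.
by rewrite mul1r add0r.
Qed.

(** With A = A0(q^2) + q A1(q^2), the even part of A^2 is A0^2 + q A1^2, to which induction applies
    at about half the index, and the odd part is 2 A0 A1. Only x^2 = x mod 2 for the constant term
    remains. *)
Lemma sqr_mod2 A : eqm 2 (A ^+ 2) (V A).
Proof.
apply/eqmP => n; have [k] := ubnP n; elim: k n A => // k IH n A nk.
have [m en] : exists m, n = m.*2 \/ n = m.*2.+1.
  exists n./2; rewrite -{1 3}(odd_double_half n).
  by case: odd; [right | left].
case: en nk => -> nk.
- rewrite -[coef (A ^+ 2) _]/(coef (bis0 (A ^+ 2)) m).
  rewrite -[coef (V A) _]/(coef (bis0 (V A)) m) bis0V expr2 bis0M -!expr2.
  have -> : coef A m = coef (V (bis0 A)) m + coef (qX * V (bis1 A)) m.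
    by rewrite -coefD -bis_decomp.
  rewrite coefD !coef_qX; case: m nk => [|m] nk.
    rewrite !addr0 expr2 coefM0 coef_sub2_0; move: (coef _ 0) => x.
    have [y [->|->]] : exists y, x = y * 2 \/ x = y * 2 + 1.
    - by exists (x %/ 2)%Z; lia.
    - have -> : y * 2 * (y * 2) - y * 2 = (y * y * 2 - y) * 2 by ring.
      exact: dvdz_mull.
    - have -> : (y * 2 + 1) * (y * 2 + 1) - (y * 2 + 1) = (y * y * 2 + y) * 2
      by ring.
      exact: dvdz_mull.
  rewrite opprD addrACA rpredD // IH //; lia.
- rewrite -[coef (A ^+ 2) _]/(coef (bis1 (A ^+ 2)) m).
  rewrite -[coef (V A) _]/(coef (bis1 (V A)) m) bis1V expr2 bis1M coef0 subr0.
  by rewrite mulrC -mulr2n coefMn; move: (coef _ m) => x; lia.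
Qed.

End Congruence.

(** * The classes 8n+7, 16n+10 and 16n+14 *)

Section PowersOfTwo.
Local Open Scope ring_scope.

Lemma phiNi_exp k : phiNi ^+ k = phi ^+ k * V (phiNi ^+ (2 * k)).
Proof. by rewrite {1}phiNiE exprMn -(rmorphXn V) -exprM. Qed.

Lemma phi_sq_mod4 : eqm 4 (phi ^+ 2) (V (phi ^+ 2)).
Proof. by exists (qX * V (V psi) ^+ 2); rewrite {1}phi_sq rmorphXn. Qed.

(** phi^14 is the seventh power of phi^2, which modulo 4 is a series in q^2 and so has no odd
    part. *)
Lemma bis1_phi14 A : eqm 4 (bis1 (phi ^+ 14 * V A)) 0.
Proof.
rewrite bis1MV -(mul0r A); apply: eqmM (eqm_refl _ _).
rewrite (exprM phi 2 7) -(bis1V (phi ^+ 2 ^+ 7)).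
apply: eqm_additive; rewrite rmorphXn; apply: eqmX; exact: phi_sq_mod4.
Qed.

Lemma bis0_P8 : bis0 P8 = phi ^+ 2 * V (phi ^+ 5 * V (phiNi ^+ 9)).
Proof.
rewrite P8E bis0MV bis0_phi mulrCA -(rmorphM V) mulrA -exprS.
by [].
Qed.

Lemma bis1_bis0_P8 :
  bis1 (bis0 P8) = phi ^+ 5 * V (phi * V psi * phiNi ^+ 9) *+ 4.
Proof.
rewrite bis0_P8 bis1MV bis1_phi2 mulrnAl mulrCA -(rmorphM V).
by [].
Qed.

(** The three odd bisections act on phi, phi^2 and phi^4 in turn and contribute the factors 2, 4 and
    8. *)
Lemma P8_8n7 : exists A, bis1 (bis1 (bis1 P8)) = A *+ 64.
Proof.
have -> : bis1 P8 = phi ^+ 2 * V (V psi * phi ^+ 4 * V (phiNi ^+ 9)) *+ 2.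
  by rewrite P8E bis1MV bis1_phi mulrnAl mulrCA -(rmorphM V) mulrA.
have -> : bis1 (phi ^+ 2 * V (V psi * phi ^+ 4 * V (phiNi ^+ 9)) *+ 2) =
    phi ^+ 4 * V (phi * V psi * psi * phiNi ^+ 9) *+ 8.
  rewrite raddfMn /= bis1MV bis1_phi2; move: (phiNi ^+ 9) => y.
  by rewrite !(rmorphM V) /=; ring.
rewrite raddfMn /= bis1MV bis1_phi4 mulrnAl -mulrnA.
by eexists.
Qed.

(** One factor 4 comes from [bis1_bis0_P8]. Modulo 4 the even part of phi^5 is phi(q^2) phi^4; with
    phi and the phi^9 extracted from [phiNi ^+ 9] this makes phi^14, whose odd part supplies the
    other 4. *)
Lemma P8_16n10 : exists A, bis1 (bis0 (bis1 (bis0 P8))) = A *+ 16.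
Proof.
rewrite bis1_bis0_P8 raddfMn /= bis0MV raddfMn /=.
suff : eqm 4 (bis1 (bis0 (phi ^+ 5) * (phi * V psi * phiNi ^+ 9))) 0.
  by case=> A ->; exists A; rewrite add0r -mulrnA.
apply: eqm_trans (bis1_phi14 (phi * psi * phiNi ^+ 18)).
apply: (eqm_additive bis1).
have -> : phi ^+ 14 * V (phi * psi * phiNi ^+ 18) =
  V phi * phi ^+ 4 * (phi * V psi * phiNi ^+ 9).
  rewrite (phiNi_exp 9) [(2 * 9)%N]/=; move: (phiNi ^+ 18) => y.
  by rewrite !(rmorphM V) /=; ring.
apply: eqmM (eqm_refl _ _).
rewrite exprS bis0M bis0_phi bis1_phi bis0_phi4 bis1_phi4.
exists (V phi * qX * V psi ^+ 4 *+ 4 + qX * V (V psi) * phi ^+ 2 * V psi ^+ 2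
  *+ 4).
ring.
Qed.

(** After the factor 4 of [bis1_bis0_P8], the odd part of phi^5 gives 2 phi^14 times a series in
    q^2, plus a multiple of 8; the last odd bisection of phi^14 adds another 4, so 8 divides
    both. *)
Lemma P8_16n14 : exists A, bis1 (bis1 (bis1 (bis0 P8))) = A *+ 32.
Proof.
rewrite bis1_bis0_P8 raddfMn /= bis1MV raddfMn /=.
have [B hB] := bis1_phi14 (V psi * psi * phiNi ^+ 18).
have -> : bis1 (phi ^+ 5) = V phi * (phi ^+ 2 * V psi ^+ 2 *+ 8) +
    V (V psi) *+ 2 * (phi ^+ 4 + qX * V psi ^+ 4 *+ 16).
  by rewrite (exprS phi 4) bis1M bis0_phi bis1_phi bis0_phi4 bis1_phi4.
set W := (X in bis1 X).
have -> : W = phi ^+ 14 * V (V psi * psi * phiNi ^+ 18) *+ 2 +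
   (V phi * phi ^+ 2 * V psi ^+ 2 + V (V psi) * qX * V psi ^+ 4 *+ 4) *
   (phi * V psi * phiNi ^+ 9) *+ 8.
  rewrite /W (phiNi_exp 9) [(2 * 9)%N]/=; move: (phiNi ^+ 18) => y.
  by rewrite !(rmorphM V) /=; ring.
rewrite raddfD !raddfMn /= hB; set C := bis1 _.
by exists (B + C); ring.
Qed.

End PowersOfTwo.

(** * The series of pbar(4n), and its reduction modulo 32 and 16 to short products *)

Section EvenPart.
Local Open Scope ring_scope.

Lemma bis0_bis0_P8 : bis0 (bis0 P8) = phi ^+ 7 * V (phiNi ^+ 9).
Proof.
rewrite bis0_P8 bis0MV bis0_phi2 mulrA; congr (_ * _).
by rewrite -exprD.
Qed.

(** The inverse of phi(-q) has the form 1 + 2u, and each of the four squarings doubles the modulus,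
    from 2 up to 32. *)
Lemma phiNi_exp16 : eqm 32 (phiNi ^+ 16) 1.
Proof.
have e : phiNi = 1 + (- (alt theta * phiNi)) *+ 2.
  have := phiNK; have -> : phiN = 1 + alt theta *+ 2.
    by rewrite /phiN /phi raddfD raddfMn /= rmorph1.
  by move: phiNi (alt theta) => y u <-; ring.
rewrite e; move: (- _) => u {e}.
have s1 x : (1 + x *+ 2) ^+ 2 = 1 + (x + x ^+ 2) *+ 4 :> fps by ring.
have s2 x : (1 + x *+ 4) ^+ 2 = 1 + (x + x ^+ 2 *+ 2) *+ 8 :> fps by ring.
have s3 x : (1 + x *+ 8) ^+ 2 = 1 + (x + x ^+ 2 *+ 4) *+ 16 :> fps by ring.
have s4 x : (1 + x *+ 16) ^+ 2 = 1 + (x + x ^+ 2 *+ 8) *+ 32 :> fps by ring.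
by rewrite (exprM _ 2 8) s1 (exprM _ 2 4) s2 (exprM _ 2 2) s3 s4; eexists.
Qed.

(* Meant for [a = (phi - 1) / 2], with [c], [d], [e] its iterated images by [V]. *)
Lemma reduction32 (a c d e : fps) : eqm 2 (a ^+ 2) c -> eqm 2 (c ^+ 2) d ->
  eqm 2 (d ^+ 2) e ->
  let f1 := 1 + a *+ 2 in let f2 := 1 + c *+ 2 in
  let f4 := 1 + d *+ 2 in let f8 := 1 + e *+ 2 in
  eqm 32 (f1 ^+ 7 * (f8 *+ 2 - f2) ^+ 7)
   (4 + f8 ^+ 2 *+ 4 - f4 *+ 2 + f4 * f8 *+ 4 + f2 * f8 *+ 8 + f2 * f4 *+ 2
    + f2 ^+ 2 *+ 11 + f1 * f8 *+ 2 + f1 * f4 *+ 2 - f1 * f2 *+ 3 - f1 ^+ 2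
    + (f1 ^+ 3 *+ 3 - f1 ^+ 2 * f2 *+ 3 + f1 * f2 ^+ 2 *+ 3 - f2 ^+ 3 *+ 3
       + f1 * f2 * f4 *+ 2)).
Proof.
move=> [X hX] [Y hY] [W hW] f1 f2 f4 f8.
(* The coefficients 2^k binomial(7, k) are separated into residues and multiples of 32. *)
have p7 (x : fps) : (1 + x *+ 2) ^+ 7 = 1 + x *+ 14 + x ^+ 2 *+ 20 + x ^+ 3 *+
  24
    + x ^+ 4 *+ 16 + (x ^+ 2 *+ 2 + x ^+ 3 *+ 8 + x ^+ 4 *+ 17 + x ^+ 5 *+ 21
    + x ^+ 6 *+ 14 + x ^+ 7 *+ 4) *+ 32 by ring.
pose b := e *+ 2 - c.
have -> : f8 *+ 2 - f2 = 1 + b *+ 2 by rewrite /f8 /f2 /b; ring.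
apply: (@eqm_trans _ ((1 + a *+ 14 + a ^+ 2 *+ 20 + a ^+ 3 *+ 24 + a ^+ 4 *+ 16)
  * (1 + b *+ 14 + b ^+ 2 *+ 20 + b ^+ 3 *+ 24 + b ^+ 4 *+ 16))).
  by apply: eqmM; rewrite p7; eexists.
apply: (@eqm_trans _ (1 + (a + b) *+ 14 + a ^+ 2 *+ 20 + a * b *+ 4
  + b ^+ 2 *+ 20 + (a ^+ 3 + a ^+ 2 * b + a * b ^+ 2 + b ^+ 3) *+ 24
  + (a ^+ 4 + a ^+ 3 * b + a ^+ 2 * b ^+ 2 + a * b ^+ 3 + b ^+ 4) *+ 16)).
  exists (a * b *+ 6 + a ^+ 2 * b *+ 8 + a * b ^+ 2 *+ 8 + a ^+ 3 * b *+ 10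
    + a * b ^+ 3 *+ 10 + a ^+ 4 * b *+ 7 + a * b ^+ 4 *+ 7
    + a ^+ 2 * b ^+ 2 *+ 12 + a ^+ 3 * b ^+ 2 *+ 15 + a ^+ 2 * b ^+ 3 *+ 15
    + a ^+ 4 * b ^+ 2 *+ 10 + a ^+ 2 * b ^+ 4 *+ 10 + a ^+ 3 * b ^+ 3 *+ 18
    + a ^+ 4 * b ^+ 3 *+ 12 + a ^+ 3 * b ^+ 4 *+ 12 + a ^+ 4 * b ^+ 4 *+ 8).
  by ring.
(* Modulo 32 the difference of the two sides is 16 times a combination of a^2 - c, c^2 - d and d^2 -
   e, with cofactors [p1], [p2] and 1; these three are even, and [Z - f2] collects the exact
   multiples of 32. *)
pose p1 := e + a ^+ 2 + c + a * c + c ^+ 2.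
pose p2 := e + 1 + a + c + a * c + c ^+ 2 + d.
have q1 : a ^+ 2 - c = X *+ 2 by rewrite hX; ring.
have q2 : c ^+ 2 - d = Y *+ 2 by rewrite hY; ring.
have q3 : d ^+ 2 - e = W *+ 2 by rewrite hW; ring.
pose Z : fps := e ^+ 2 *+ 2 + e ^+ 3 *+ 6 + e ^+ 4 *+ 8 - c * e *+ 3
  - c * e ^+ 2 *+ 9 - c * e ^+ 3 *+ 16 + c ^+ 2 * e *+ 4 + c ^+ 2 * e ^+ 2 *+ 12
  - c ^+ 3 * e *+ 4 + a * e ^+ 2 *+ 3 + a * e ^+ 3 *+ 4 - a * c * e *+ 3
  - a * c * e ^+ 2 *+ 6 + a * c ^+ 2 * e *+ 3 - a * c ^+ 3 + a ^+ 2 * e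
  + a ^+ 2 * e ^+ 2 *+ 2 - a ^+ 2 * c * e *+ 2 + a ^+ 3 * e - a ^+ 3 * c.
exists (Z - f2 + p1 * X + p2 * Y + W).
have -> : (Z - f2 + p1 * X + p2 * Y + W) *+ 32 = (Z - f2) *+ 32 +
  (p1 * (X *+ 2) + p2 * (Y *+ 2) + W *+ 2) *+ 16 by ring.
rewrite -q1 -q2 -q3 /Z /p1 /p2 /f1 /f2 /f4 /f8 /b; ring.
Qed.

(** The analogue modulo 16, where products of at most two values of phi suffice; the last bracket
    gathers the terms that vanish only jointly, in [vanish5_binary]. *)
Lemma reduction16 (a c d e : fps) : eqm 2 (a ^+ 2) c -> eqm 2 (c ^+ 2) d ->
  let f1 := 1 + a *+ 2 in let f2 := 1 + c *+ 2 in
  let f4 := 1 + d *+ 2 in let f8 := 1 + e *+ 2 in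
  eqm 16 (f1 ^+ 7 * (f8 *+ 2 - f2) ^+ 7)
   (- 8 + f8 *+ 12 - f2 *+ 12 + f2 * f4 *+ 2 + f1 * f8 *+ 2 + f1 * f2
    + (f2 ^+ 2 + f1 * f4 *+ 2 + f1 ^+ 2)).
Proof.
move=> [X hX] [Y hY] f1 f2 f4 f8.
have p7 (x : fps) : (1 + x *+ 2) ^+ 7 = 1 + x *+ 14 + x ^+ 2 *+ 4 + x ^+ 3 *+ 8
    + (x ^+ 2 *+ 5 + x ^+ 3 *+ 17 + x ^+ 4 *+ 35 + x ^+ 5 *+ 42
    + x ^+ 6 *+ 28 + x ^+ 7 *+ 8) *+ 16 by ring.
pose b := e *+ 2 - c.
have -> : f8 *+ 2 - f2 = 1 + b *+ 2 by rewrite /f8 /f2 /b; ring.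
apply: (@eqm_trans _ ((1 + a *+ 14 + a ^+ 2 *+ 4 + a ^+ 3 *+ 8)
  * (1 + b *+ 14 + b ^+ 2 *+ 4 + b ^+ 3 *+ 8))).
  by apply: eqmM; rewrite p7; eexists.
apply: (@eqm_trans _ (1 + (a + b) *+ 14 + (a ^+ 2 + a * b + b ^+ 2) *+ 4
  + (a ^+ 3 + a ^+ 2 * b + a * b ^+ 2 + b ^+ 3) *+ 8)).
  exists (a * b *+ 12 + a ^+ 2 * b *+ 3 + a * b ^+ 2 *+ 3 + a ^+ 3 * b *+ 7
    + a * b ^+ 3 *+ 7 + a ^+ 2 * b ^+ 2 + a ^+ 3 * b ^+ 2 *+ 2
    + a ^+ 2 * b ^+ 3 *+ 2 + a ^+ 3 * b ^+ 3 *+ 4).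
  by ring.
have q1 : a ^+ 2 - c = X *+ 2 by rewrite hX; ring.
have q2 : c ^+ 2 - d = Y *+ 2 by rewrite hY; ring.
pose Z : fps := e ^+ 2 + e ^+ 3 *+ 4 - c * e - c * e ^+ 2 *+ 6 + c ^+ 2 * e *+ 3
  - c ^+ 3 + a * e ^+ 2 *+ 2 - a * c * e *+ 2 + a ^+ 2 * e - a ^+ 2 * c.
exists (Z + (a + c) * X + (1 + a + c) * Y).
have -> : (Z + (a + c) * X + (1 + a + c) * Y) *+ 16 = Z *+ 16 +
  ((a + c) * (X *+ 2) + (1 + a + c) * (Y *+ 2)) *+ 8 by ring.
rewrite -q1 -q2 /Z /f1 /f2 /f4 /f8 /b; ring.
Qed.

End EvenPart.

(** * Coefficients at 2^j (8n + r) for r = 7 and r = 5 *)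

Section Vanishing.
Local Open Scope ring_scope.

Definition dvd_class r k A := forall n, (k%:Z %| coef A (8 * n + r))%Z.
Definition vanish r k A :=
  forall j n, (k%:Z %| coef A (2 ^ j * (8 * n + r)))%Z.

(** 7 is 111 in binary, hence three odd bisections; for 5, which is 101, the middle one is even. *)
Lemma dvd_class7 k A : eqm k (bis1 (bis1 (bis1 A))) 0 -> dvd_class 7 k A.
Proof.
move=> /eqmP h n; have := h n; rewrite coef0 subr0 /=.
by have -> : (n.*2.+1.*2.+1.*2.+1 = 8 * n + 7)%N by lia.
Qed.

Lemma dvd_class5 k A : eqm k (bis1 (bis0 (bis1 A))) 0 -> dvd_class 5 k A.
Proof.
move=> /eqmP h n; have := h n; rewrite coef0 subr0 /=.
by have -> : (n.*2.+1.*2.*2.+1 = 8 * n + 5)%N by lia.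
Qed.

Lemma vanish_eqm r k A B : eqm k A B -> vanish r k B -> vanish r k A.
Proof.
by move=> /eqmP h hB j n; have := rpredD (h (2 ^ j * (8 * n + r))%N) (hB j n);
  rewrite subrK.
Qed.

Lemma vanishD r k A B : vanish r k A -> vanish r k B -> vanish r k (A + B).
Proof. by move=> hA hB j n; rewrite coefD rpredD. Qed.

Lemma vanishN r k A : vanish r k A -> vanish r k (- A).
Proof. by move=> hA j n; rewrite coefN rpredN. Qed.

Lemma vanishB r k A B : vanish r k A -> vanish r k B -> vanish r k (A - B).
Proof. by move=> hA hB; apply: vanishD => //; apply: vanishN. Qed.

Lemma vanishMn r k A m : vanish r k A -> vanish r k (A *+ m).
Proof. by move=> hA j n; rewrite coefMn rpredMn. Qed.

Lemma coef_bis0_pow r A j n : coef A (2 ^ j.+1 * (8 * n + r)) =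
  coef (bis0 A) (2 ^ j * (8 * n + r)).
Proof. by rewrite expnS -mulnA mul2n. Qed.

Lemma vanish_step r k A : dvd_class r k A -> vanish r k (bis0 A) -> vanish r k
  A.
Proof.
by move=> h0 hS [|j] n; [rewrite mul1n; apply: h0 | rewrite coef_bis0_pow].
Qed.

(** Doubling the index acts as [bis0], here of period 2, so only j = 0 and j = 1 remain. *)
Lemma vanish_period2 r k A : dvd_class r k A -> dvd_class r k (bis0 A) ->
  bis0 (bis0 A) = A -> vanish r k A.
Proof.
move=> h0 h1 e j; have [m] := ubnP j; elim: m j => // m IH [|[|j]] jm n.
- by rewrite mul1n; apply: h0.
- by rewrite coef_bis0_pow mul1n; apply: h1.
by rewrite !coef_bis0_pow e; apply: IH; lia.
Qed.

Lemma dvd_classV r k A : odd r -> dvd_class r k (V A).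
Proof. by move=> hr n; rewrite /= oddD oddM hr. Qed.

Lemma vanishV r k A : odd r -> vanish r k A -> vanish r k (V A).
Proof.
by move=> hr hA; apply: vanish_step; rewrite ?bis0V //; apply: dvd_classV.
Qed.

Lemma vanish1 r k : odd r -> vanish r k 1.
Proof.
by move=> hr; apply: vanish_period2; rewrite ?bis01 // -(rmorph1 V);
  apply: dvd_classV.
Qed.

Lemma dvd_class7_0 k A : bis1 (bis1 (bis1 A)) = 0 -> dvd_class 7 k A.
Proof. by move=> e; apply: dvd_class7; rewrite e; apply: eqm_refl. Qed.

Lemma dvd_class5_0 k A : bis1 (bis0 (bis1 A)) = 0 -> dvd_class 5 k A.
Proof. by move=> e; apply: dvd_class5; rewrite e; apply: eqm_refl. Qed.

Let zeros := (mul0rn, raddf0 bis0, raddf0 bis1).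
Let simp := (raddfMn bis0, raddfMn bis1).
Let lin := (raddfN bis0, raddfN bis1, raddfMn bis0, raddfMn bis1, raddfD bis0,
  raddfD bis1).

Lemma vanish7_phi k : vanish 7 k phi.
Proof.
apply: vanish_period2; rewrite ?bis0_phi ?bis0V //; last exact: dvd_classV.
by apply: dvd_class7_0; rewrite bis1_phi !simp /= bis1V !zeros.
Qed.

Lemma vanish5_phi k : vanish 5 k phi.
Proof.
apply: vanish_period2; rewrite ?bis0_phi ?bis0V //; last exact: dvd_classV.
by apply: dvd_class5_0; rewrite bis1_phi !simp /= bis0V bis1V !zeros.
Qed.

Lemma vanish7_phi_sq k : vanish 7 k (phi ^+ 2).
Proof.
have h : dvd_class 7 k (phi ^+ 2).
  by apply: dvd_class7_0; rewrite bis1_phi2 !simp /= bis1V !zeros.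
by apply: vanish_period2; rewrite ?bis0_phi2.
Qed.

Lemma bis0_phi_phi2 : bis0 (phi * V phi) = phi * V phi.
Proof. by rewrite bis0MV bis0_phi mulrC. Qed.

Lemma bis1_phiV A : bis1 (phi * V A) = A * V (V psi) *+ 2.
Proof. by rewrite bis1MV bis1_phi mulrnAl mulrC. Qed.

Lemma bis0_phiV A : bis0 (phi * V A) = A * V phi.
Proof. by rewrite bis0MV bis0_phi mulrC. Qed.

Lemma vanish7_phi_phi2 k : vanish 7 k (phi * V phi).
Proof.
have h : dvd_class 7 k (phi * V phi).
  apply: dvd_class7_0; rewrite bis1_phiV !simp /= bis1_phiV !simp /=.
  by rewrite -(rmorphM V) bis1V !zeros.
by apply: vanish_period2; rewrite ?bis0_phi_phi2.
Qed.

Lemma vanish5_phi_phi2 k : vanish 5 k (phi * V phi).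
Proof.
have h : dvd_class 5 k (phi * V phi).
  apply: dvd_class5_0; rewrite bis1_phiV !simp /= bis0_phiV.
  by rewrite -(rmorphM V) bis1V !zeros.
by apply: vanish_period2; rewrite ?bis0_phi_phi2.
Qed.

Lemma vanish7_phi_phi4 k : vanish 7 k (phi * V (V phi)).
Proof.
apply: vanish_step.
  apply: dvd_class7_0; rewrite bis1_phiV !simp /= -(rmorphM V) bis1V.
  by rewrite !zeros.
rewrite bis0_phiV -(rmorphM V) -expr2; apply: vanishV => //.
exact: vanish7_phi_sq.
Qed.

Lemma vanish7_phi_phi8 k : vanish 7 k (phi * V (V (V phi))).
Proof.
apply: vanish_step.
  apply: dvd_class7_0; rewrite bis1_phiV !simp /= -(rmorphM V) bis1V.
  by rewrite !zeros.
rewrite bis0_phiV mulrC -(rmorphM V); apply: vanishV => //.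
exact: vanish7_phi_phi2.
Qed.

Lemma vanish5_phi_phi8 k : vanish 5 k (phi * V (V (V phi))).
Proof.
apply: vanish_step.
  apply: dvd_class5_0; rewrite bis1_phiV !simp /= -(rmorphM V) bis0V.
  by rewrite -(rmorphM V) bis1V !zeros.
rewrite bis0_phiV mulrC -(rmorphM V); apply: vanishV => //.
exact: vanish5_phi_phi2.
Qed.

Lemma bis101_phi_sq :
  bis1 (bis0 (bis1 (phi ^+ 2))) = psi * V (V psi) *+ 8.
Proof.
by rewrite bis1_phi2 !simp /= bis0V bis1_phiV -mulrnA.
Qed.

Lemma bis101_phi_phi4 :
  bis1 (bis0 (bis1 (phi * V (V phi)))) = psi * V (V psi) *+ 4.
Proof.
rewrite bis1_phiV !simp /= -(rmorphM V) bis0V bis1_phiV.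
by rewrite -mulrnA.
Qed.

Lemma vanish5_phi_sq2 : vanish 5 16 (phi ^+ 2 *+ 2).
Proof.
have h : dvd_class 5 16 (phi ^+ 2 *+ 2).
  apply: dvd_class5; rewrite !simp /= bis101_phi_sq.
  by exists (psi * V (V psi)); rewrite -!mulrnA add0r.
by apply: vanish_period2;
  rewrite ?raddfMn /= ?bis0_phi2 // raddfMn /= bis0_phi2.
Qed.

(** At j = 0 the last two terms contribute 2 * 4 and 8 times psi(q) psi(q^4), and only their sum
    reaches 16. *)
Lemma vanish5_binary :
  vanish 5 16 (V phi ^+ 2 + phi * V (V phi) *+ 2 + phi ^+ 2).
Proof.
apply: vanish_step.
  apply: dvd_class5; rewrite -(rmorphXn V) !lin /= bis1V
    bis101_phi_phi4 bis101_phi_sq !zeros.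
  by exists (psi * V (V psi)); ring.
rewrite -(rmorphXn V) !lin /= bis0V bis0_phi2 bis0_phiV.
(* After one doubling the three terms regroup into 2 phi^2 and its image by [V]. *)
have -> : phi ^+ 2 + V phi * V phi *+ 2 + phi ^+ 2 =
  phi ^+ 2 *+ 2 + V (phi ^+ 2 *+ 2).
  by rewrite (raddfMn V) /= (rmorphXn V) /=; ring.
by apply: vanishD; [|apply: vanishV]; rewrite //; apply: vanish5_phi_sq2.
Qed.

Lemma bis111_phi_cube : bis1 (bis1 (bis1 (phi ^+ 3))) = 0.
Proof.
have -> : bis1 (phi ^+ 3) = phi ^+ 2 * V (V psi) *+ 2 +
    V (phi ^+ 2 * V psi) *+ 4.
  rewrite (exprS phi 2) bis1M bis0_phi bis1_phi bis0_phi2 bis1_phi2.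
  by rewrite mulrnAr -(rmorphM V) mulrA -expr2 addrC; ring.
by rewrite !lin /= bis1MV bis1_phi2 bis1V mulrnAl -(rmorphM V) !lin /= bis1V
  !zeros addr0.
Qed.

Lemma bis111_phi_sq_phi2 :
  bis1 (bis1 (bis1 (phi ^+ 2 * V phi))) = psi * V psi * V (V psi) *+ 16.
Proof.
have -> : bis1 (phi ^+ 2 * V phi) = phi * V (phi * V psi) *+ 4.
  by rewrite bis1MV bis1_phi2 mulrnAl mulrC.
rewrite !lin /= bis1_phiV.
have -> : phi * V psi * V (V psi) = phi * V (psi * V psi).
  by rewrite (rmorphM V) mulrA.
by rewrite !lin /= bis1_phiV -!mulrnA.
Qed.

Lemma bis111_phi_phi2_sq : bis1 (bis1 (bis1 (phi * V phi ^+ 2))) = 0.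
Proof.
rewrite -(rmorphXn V) bis1_phiV !lin /= bis1MV bis1_phi2 mulrnAl -(rmorphM V).
by rewrite !lin /= bis1V !zeros.
Qed.

Lemma bis111_phi_phi2_phi4 :
  bis1 (bis1 (bis1 (phi * V phi * V (V phi)))) = psi * V psi * V (V psi) *+ 8.
Proof.
rewrite -mulrA -(rmorphM V) bis1_phiV -mulrA -(rmorphM V) !lin /= bis1_phiV.
have -> : phi * V psi * V (V psi) = phi * V (psi * V psi).
  by rewrite (rmorphM V) mulrA.
by rewrite !lin /= bis1_phiV -!mulrnA.
Qed.

(** [phi_sq] eliminates q psi(q^4)^2, which keeps the result in the span of cubics in phi. *)
Lemma bis0_phi_cube : bis0 (phi ^+ 3) = phi ^+ 2 * V phi *+ 3 - V phi ^+ 3 *+ 2.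
Proof.
rewrite (exprS phi 2) bis0M bis0_phi bis1_phi bis0_phi2 bis1_phi2 (rmorphM V)
  /=.
by rewrite phi_sq; ring.
Qed.

Lemma bis0_phi_sq_phi2 : bis0 (phi ^+ 2 * V phi) = phi ^+ 3.
Proof. by rewrite bis0MV bis0_phi2 -exprSr. Qed.

(* [bis0] preserves the span of the three cubics, hence one joint induction. *)
Lemma vanish7_cubics : [/\ vanish 7 32 (phi ^+ 3 *+ 2),
  vanish 7 32 (phi ^+ 2 * V phi *+ 2) & vanish 7 32 (V phi ^+ 3 *+ 2)].
Proof.
suff h j : (forall n, (32 %| coef (phi ^+ 3 *+ 2) (2 ^ j * (8 * n + 7)))%Z) /\
  (forall n, (32 %| coef (phi ^+ 2 * V phi *+ 2) (2 ^ j * (8 * n + 7)))%Z) /\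
  (forall n, (32 %| coef (V (phi ^+ 3) *+ 2) (2 ^ j * (8 * n + 7)))%Z).
  by split=> j n; have [ha [hb hc]] := h j; rewrite -?(rmorphXn V).
elim: j => [|j [ha [hb hc]]].
  split; [|split] => n; rewrite mul1n; move: n; apply: (@dvd_class7 32).
  - by rewrite !lin /= bis111_phi_cube mul0rn; apply: eqm_refl.
  - rewrite !lin /= bis111_phi_sq_phi2 -mulrnA.
    by exists (psi * V psi * V (V psi)); rewrite add0r.
  - by rewrite !lin /= bis1V !zeros; apply: eqm_refl.
have bis0Mn A k : bis0 (A *+ k) = bis0 A *+ k by exact: raddfMn.
split; [|split] => n; rewrite coef_bis0_pow bis0Mn.
- rewrite bis0_phi_cube -(rmorphXn V) mulrnBl mulrnAC [X in _ - X]mulrnAC coefD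
  coefN.
  by rewrite rpredB // coefMn rpredMn.
- by rewrite bis0_phi_sq_phi2.
- by rewrite bis0V.
Qed.

Lemma vanish7_ternary :
  vanish 7 32 (phi ^+ 3 *+ 3 - phi ^+ 2 * V phi *+ 3 + phi * V phi ^+ 2 *+ 3
    - V phi ^+ 3 *+ 3 + phi * V phi * V (V phi) *+ 2).
Proof.
have [ha hb hd] := vanish7_cubics.
apply: vanish_step.
  apply: dvd_class7; rewrite !lin /= -[V phi ^+ 3](rmorphXn V) bis111_phi_cube
   bis111_phi_sq_phi2 bis111_phi_phi2_sq bis111_phi_phi2_phi4 bis1V !zeros.
  (* The second and last terms contribute -3 * 16 + 2 * 8 = -32; the others contribute 0. *)
  by exists (- (psi * V psi * V (V psi))); ring.
rewrite !lin /= bis0_phi_cube bis0_phi_sq_phi2 -[V phi ^+ 3](rmorphXn V) bis0V.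
rewrite -(rmorphXn V) bis0_phiV.
have -> : bis0 (phi * V phi * V (V phi)) = phi * V phi ^+ 2.
  by rewrite bis0MV bis0_phiV; ring.
have hc : vanish 7 32 (phi * V phi ^+ 2 *+ 2).
  apply: vanish_step; last by rewrite -(rmorphXn V) !lin /= bis0_phiV.
  apply: dvd_class7; rewrite !lin /= bis111_phi_phi2_sq mul0rn.
  exact: eqm_refl.
set W := (X in vanish _ _ X).
(* After one doubling all coefficients are even, so the doubled cubics suffice. *)
have -> : W = (phi ^+ 2 * V phi *+ 2) *+ 6 - (V phi ^+ 3 *+ 2) *+ 3
  - (phi ^+ 3 *+ 2) *+ 3 + phi * V phi ^+ 2 *+ 2.
  by rewrite /W (rmorphXn V) /=; ring.
exact: vanishD (vanishB (vanishB (vanishMn 6 hb) (vanishMn 3 hd)) (vanishMn 3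
  ha)) hc.
Qed.

(** By [phiNi_exp16], phi(-q)^(-9) is phi(-q)^7 modulo 32, which replaces the quotient by a
    polynomial in values of phi. *)
Lemma bis0_bis0_P8_mod32 :
  eqm 32 (bis0 (bis0 P8)) (phi ^+ 7 * (V (V (V phi)) *+ 2 - V phi) ^+ 7).
Proof.
have -> : V (V (V phi)) *+ 2 - V phi = V phiN.
  by rewrite phiNE raddfB raddfMn.
rewrite bis0_bis0_P8 -(rmorphXn V); apply: eqmM (eqm_refl _ _) _.
apply: (eqm_additive V).
have := eqmM (eqm_refl 32 (phiN ^+ 7)) phiNi_exp16.
by rewrite mulr1 (exprD phiNi 7 9) mulrA -exprMn phiNK expr1n mul1r.
Qed.

Lemma sub2_1D2 A : V (1 + A *+ 2) = 1 + V A *+ 2.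
Proof. by rewrite raddfD raddfMn /= rmorph1. Qed.

Lemma eqm_sub2_sq k A B : eqm k (A ^+ 2) B -> eqm k (V A ^+ 2) (V B).
Proof. by move=> /(eqm_additive V); rewrite /= rmorphXn. Qed.

Lemma vanish7_bis0_bis0_P8 : vanish 7 32 (bis0 (bis0 P8)).
Proof.
apply: vanish_eqm bis0_bis0_P8_mod32 _.
have th := sqr_mod2 theta.
have := reduction32 th (eqm_sub2_sq th) (eqm_sub2_sq (eqm_sub2_sq th)).
rewrite /= -!sub2_1D2 -/phi => h; apply: vanish_eqm h _.
apply: vanishD vanish7_ternary.
(* The terms with at most two factors vanish one by one; their multiples are added with the
   coefficients of [reduction32]. *)
have v1 := vanishMn 4 (@vanish1 7 32 isT).
have vanV A : vanish 7 32 A -> vanish 7 32 (V A) by exact: vanishV.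
have h88 : vanish 7 32 (V (V (V phi)) ^+ 2).
  by rewrite -!(rmorphXn V); do 3!apply: (vanV _); apply: vanish7_phi_sq.
have h22 : vanish 7 32 (V phi ^+ 2).
  by rewrite -(rmorphXn V); apply: vanV; apply: vanish7_phi_sq.
have h4 : vanish 7 32 (V (V phi)) by do 2!apply: (vanV _); apply: vanish7_phi.
have h48 : vanish 7 32 (V (V phi) * V (V (V phi))).
  by rewrite -!(rmorphM V); do 2!apply: (vanV _); apply: vanish7_phi_phi2.
have h28 : vanish 7 32 (V phi * V (V (V phi))).
  by rewrite -!(rmorphM V); apply: vanV; apply: vanish7_phi_phi4.
have h24 : vanish 7 32 (V phi * V (V phi)).
  by rewrite -!(rmorphM V); apply: vanV; apply: vanish7_phi_phi2.
have := vanishD (vanishB (vanishD v1 (vanishMn 4 h88)) (vanishMn 2 h4))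
  (vanishMn 4 h48).
move=> /vanishD/(_ (vanishMn 8 h28))/vanishD/(_ (vanishMn 2 h24)).
move=> /vanishD/(_ (vanishMn 11 h22)).
move=> /vanishD/(_ (vanishMn 2 (@vanish7_phi_phi8 32))).
move=> /vanishD/(_ (vanishMn 2 (@vanish7_phi_phi4 32))).
move=> /vanishB/(_ (vanishMn 3 (@vanish7_phi_phi2 32))).
by move=> /vanishB/(_ (@vanish7_phi_sq 32)).
Qed.

Lemma vanish5_bis0_bis0_P8 : vanish 5 16 (bis0 (bis0 P8)).
Proof.
have [C e] := bis0_bis0_P8_mod32; have {e} : eqm 16 (bis0 (bis0 P8))
    (phi ^+ 7 * (V (V (V phi)) *+ 2 - V phi) ^+ 7).
  by exists (C *+ 2); rewrite e -mulrnA.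
move=> h; apply: vanish_eqm h _.
have th := sqr_mod2 theta.
have := reduction16 (V (V (V theta))) th (eqm_sub2_sq th).
rewrite /= -!sub2_1D2 -/phi => h; apply: vanish_eqm h _.
apply: vanishD vanish5_binary.
have v1 := vanishN (vanishMn 8 (@vanish1 5 16 isT)).
have vanV A : vanish 5 16 A -> vanish 5 16 (V A) by exact: vanishV.
have h2 : vanish 5 16 (V phi) by apply: vanV; apply: vanish5_phi.
have h8 : vanish 5 16 (V (V (V phi))) by do 2!apply: (vanV _).
have h24 : vanish 5 16 (V phi * V (V phi)).
  by rewrite -!(rmorphM V); apply: vanV; apply: vanish5_phi_phi2.
have := vanishD (vanishB (vanishD v1 (vanishMn 12 h8)) (vanishMn 12 h2))
  (vanishMn 2 h24).
move=> /vanishD/(_ (vanishMn 2 (@vanish5_phi_phi8 16))).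
by move=> /vanishD/(_ (@vanish5_phi_phi2 16)).
Qed.

End Vanishing.

(** * From divisible coefficients to the congruences for [pbar] *)

Lemma dvdz_natmul (k : nat) (x : int) : (k%:Z %| (x *+ k)%R)%Z.
Proof. by rewrite -mulr_natr natz; apply: dvdz_mull. Qed.

Lemma dvd_coef_P8 (k n : nat) :
  (k%:Z %| coef P8 n)%Z -> pbar 8 n = 0 %[mod k].
Proof. by rewrite /= natz dvdzE /= mod0n => /eqP. Qed.

Theorem theorem4p4 (n alpha : nat) (halpha : 1 <= alpha) :
  pbar 8 (6 * n + 5) = 0 %[mod 3] /\
  pbar 8 (16 * n + 10) = 0 %[mod 16] /\
  pbar 8 (2 ^ alpha * (16 * n + 10)) = 0 %[mod 16] /\
  pbar 8 (32 * n + 28) = 0 %[mod 16] /\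
  pbar 8 (16 * n + 14) = 0 %[mod 32] /\
  pbar 8 (2 ^ alpha * (8 * n + 7)) = 0 %[mod 32] /\
  pbar 8 (8 * n + 7) = 0 %[mod 64].
Proof.
have bis00 m : coef (bis0 (bis0 P8)) m = coef P8 (4 * m).
  by rewrite /= -!mul2n mulnA.
have p16n14 : (32 %| coef P8 (16 * n + 14))%Z.
  have [A e] := P8_16n14.
  have -> : coef P8 (16 * n + 14) = coef (bis1 (bis1 (bis1 (bis0 P8)))) n.
    by rewrite -[RHS]/(coef P8 _); congr coef; lia.
  by rewrite e coefMn; apply: dvdz_natmul.
split; first by apply: dvd_coef_P8; apply: pbar8_mod3.
split.
  apply: dvd_coef_P8; have [A e] := P8_16n10.
  have -> : coef P8 (16 * n + 10) = coef (bis1 (bis0 (bis1 (bis0 P8)))) n.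
    by rewrite -[RHS]/(coef P8 _); congr coef; lia.
  by rewrite e coefMn; apply: dvdz_natmul.
split.
  apply: dvd_coef_P8; case: alpha halpha => // a _.
  have := vanish5_bis0_bis0_P8 a n; rewrite bis00.
  by have -> : 4 * (2 ^ a * (8 * n + 5)) = 2 ^ a.+1 * (16 * n + 10) by rewrite
    expnS; ring.
split.
  apply: dvd_coef_P8; have := vanish7_bis0_bis0_P8 0 n; rewrite bis00 mul1n.
  have -> : 4 * (8 * n + 7) = 32 * n + 28 by lia.
  exact: dvdz_trans.
split; first exact: dvd_coef_P8.
split.
  (* For alpha = 1 the index is 16n + 14, not a multiple of 4, and has its own bisection; from alpha
     = 2 on the series of pbar(4n) applies. *)
  apply: dvd_coef_P8; case: alpha halpha => // -[_|a _].
    by have -> : 2 ^ 1 * (8 * n + 7) = 16 * n + 14 by lia.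
  have := vanish7_bis0_bis0_P8 a n; rewrite bis00.
  by have -> : 4 * (2 ^ a * (8 * n + 7)) = 2 ^ a.+2 * (8 * n + 7) by rewrite
    !expnS; ring.
apply: dvd_coef_P8; have [A e] := P8_8n7.
have -> : coef P8 (8 * n + 7) = coef (bis1 (bis1 (bis1 P8))) n.
  by rewrite -[RHS]/(coef P8 _); congr coef; lia.
by rewrite e coefMn; apply: dvdz_natmul.
Qed.
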